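(* Let $u$ be an axially symmetric function on $\mathbb{R}^3\setminus\{(x_1,0,0):x_1\in\mathbb{R}\}$ of the form $$u(x_1,x_2,x_3)=h\Bigl(x_1,\sqrt{x_2^2+x_3^2}\Bigr),$$ where $h$ is a $C^2$ function on $\mathbb{H}=\{(x,y)\in\mathbb{R}^2:y>0\}$. Then $u$ is harmonic in $\mathbb{R}^3\setminus\{(x_1,0,0):x_1\in\mathbb{R}\}$ if and only if the function $$\varphi(x,y)=h(x,y)\,y^{1/2}$$ is a solution to $$\Delta_{\mathbb{H}}\varphi+\tfrac14\varphi=0\quad\text{on }\mathbb{H}.$$
   Context: $\mathbb{H}$ is the Lobachevsky (hyperbolic) upper half-plane, with Laplace--Beltrami operator $\Delta_{\mathbb{H}}v=y^2(v_{xx}+v_{yy})$. *)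

(* Defs.v *)
From HB Require Import structures.
From mathcomp Require Import all_boot all_order all_algebra.
From mathcomp Require Import all_classical all_reals all_analysis.

Set Implicit Arguments.
Unset Strict Implicit.
Unset Printing Implicit Defensive.

Import Order.TTheory GRing.Theory Num.Theory.
Import numFieldNormedType.Exports.

Local Open Scope classical_set_scope.
Local Open Scope ring_scope.

Definition basis_vec (R : realType) (n : nat) (i : 'I_n) : 'rV[R]_n :=
  delta_mx 0 i.

Definition partial (R : realType) (n : nat) (i : 'I_n) (f : 'rV[R]_n -> R) :
  'rV[R]_n -> R := fun p => 'D_(basis_vec R i) f p.

(* Functions on U are represented by total functions. For U open (the only
   intended use) [Ck_on k U f] depends only on the values of f on U, and says
   that all partial derivatives of order <= k exist and are continuous on U.
   ['D_v f] is total, hence the explicit [derivable]. *)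
Fixpoint Ck_on (R : realType) (n k : nat) (U : set 'rV[R]_n)
    (f : 'rV[R]_n -> R) : Prop :=
  (forall p, U p -> {for p, continuous f}) /\
  match k with
  | 0%N => True
  | k'.+1 => forall i : 'I_n,
      (forall p, U p -> derivable f p (basis_vec R i)) /\
      Ck_on k' U (partial i f)
  end.

Definition laplacian (R : realType) (n : nat) (f : 'rV[R]_n -> R) :
  'rV[R]_n -> R := fun p => \sum_(i < n) partial i (partial i f) p.

Definition harmonic_on (R : realType) (n : nat) (U : set 'rV[R]_n)
    (f : 'rV[R]_n -> R) : Prop :=
  Ck_on 2 U f /\ forall p, U p -> laplacian f p = 0.

(* Coordinates are numbered from 0: (x_1, x_2, x_3) = (p 0 0, p 0 1, p 0 2)
   and (x, y) = (q 0 0, q 0 1). *)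
Definition x1_axis (R : realType) : set 'rV[R]_3 :=
  [set p | p 0 1 = 0 /\ p 0 2 = 0].

Definition point2 (R : realType) (x y : R) : 'rV[R]_2 :=
  \row_(i < 2) (if i == 0 then x else y).

Definition half_plane (R : realType) : set 'rV[R]_2 := [set q | 0 < q 0 1].

Definition laplace_beltrami (R : realType) (v : 'rV[R]_2 -> R) :
  'rV[R]_2 -> R :=
  fun q => q 0 1 ^+ 2 *
    (partial 0 (partial 0 v) q + partial 1 (partial 1 v) q).

(* Classical (C^2) solutions of Delta_H v + lambda v = 0. *)
Definition helmholtz_solution (R : realType) (lambda : R)
    (v : 'rV[R]_2 -> R) : Prop :=
  Ck_on 2 (@half_plane R) v /\
  forall q, half_plane q -> laplace_beltrami v q + lambda * v q = 0.

(* Main.v *)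
Require Import Defs.
From HB Require Import structures.
From mathcomp Require Import all_boot all_order all_algebra.
From mathcomp Require Import all_classical all_reals all_analysis.
From mathcomp Require Import ring.
Set Implicit Arguments.
Unset Strict Implicit.
Unset Printing Implicit Defensive.

Import Order.TTheory GRing.Theory Num.Theory.
Import numFieldNormedType.Exports.
Local Open Scope classical_set_scope.
Local Open Scope ring_scope.

(** With [r = sqrt (x_2^2 + x_3^2)], moving along a coordinate axis of R^3
  changes only one of the two arguments of [h (x_1, r)], so one-dimensional
  chain rules suffice. They show that [u] is C^2 and that
  [Delta u = h_xx + h_yy + h_y / y] at [(x_1, r)]; the product rule turns
  [y^2 (phi_xx + phi_yy) + phi / 4] into [y^(5/2) (h_xx + h_yy + h_y / y)].
  Since [y > 0] and every point of the half-plane is some [(x_1, r)], both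
  equations say that [h_xx + h_yy + h_y / y = 0]. *)

(** * Directional derivatives and one-dimensional chain rules *)

(** The difference quotients are the same function of [t], so a derivative can be moved between
    different spaces, base points and directions. *)
Lemma is_derive_along {R : realType} {V1 V2 : normedModType R}
    (f : V1 -> R) (g : V2 -> R) (a v : V1) (b w : V2) (d : R) :
  (forall t : R, f (t *: v + a) = g (t *: w + b)) ->
  is_derive a v f d -> is_derive b w g d.
Proof.
move=> fg.
have E : (fun t : R => t^-1 *: ((f \o shift a) (t *: v) - f a)) =
         (fun t : R => t^-1 *: ((g \o shift b) (t *: w) - g b)).
  apply/funext => t; rewrite /= !fg.
  (* The hypothesis at [t = 0] identifies the base values [f a] and [g b]. *)
  by have := fg 0; rewrite !scale0r !add0r => ->.
by case; rewrite /derivable /derive E => cf <-; exact: DeriveDef.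
Qed.

(** Restricting [g] to the line [t *: v + p] reduces this to the chain rule for functions of one
    real variable. *)
Lemma is_derive_comp {R : realType} {V : normedModType R}
    (F : R -> R) (g : V -> R) (p v : V) (a b : R) :
  is_derive (g p) 1 F a -> is_derive p v g b ->
  is_derive p v (F \o g) (a * b).
Proof.
move=> dF dg.
have dg0 : is_derive (0 : R) 1 (fun t : R => g (t *: v + p)) b.
  apply: is_derive_along dg => t.
  by rewrite addr0 /GRing.scale/= mulr1.
have E : g (0 *: v + p) = g p by rewrite scale0r add0r.
rewrite -E in dF.
have := is_derive1_comp dF dg0.
apply: is_derive_along => t /=.
by rewrite addr0 /GRing.scale/= mulr1.
Qed.

Lemma is_derive_open_eq {R : realType} {V : normedModType R} (U : set V)
    (f g : V -> R) (p v : V) (d : R) :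
  open U -> U p -> (forall q, U q -> f q = g q) ->
  is_derive p v f d -> is_derive p v g d.
Proof.
move=> oU Up fg; apply: near_eq_is_derive.
by near=> q; apply: fg; near: q; exact: open_nbhs_nbhs.
Unshelve. all: by end_near. Qed.

Lemma continuous_open_eq {T : topologicalType} {R : realType} (U : set T)
    (f g : T -> R) (p : T) :
  open U -> U p -> (forall q, U q -> f q = g q) ->
  {for p, continuous f} -> {for p, continuous g}.
Proof.
move=> oU Up fg cf.
rewrite /prop_for /continuous_at -(fg _ Up).
apply: cvg_trans cf; apply: near_eq_cvg.
by near=> q; apply: fg; near: q; exact: open_nbhs_nbhs.
Unshelve. all: by end_near. Qed.

(** * Calculus of [Ck_on] on open sets *)

Section Ck.
Context {R : realType} {n : nat}.
Implicit Types (U : set 'rV[R]_n) (f g : 'rV[R]_n -> R).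

Lemma Ck_on_continuous k U f p :
  Ck_on k U f -> U p -> {for p, continuous f}.
Proof. by case: k => [|k] [cf _]; exact: cf. Qed.

Lemma Ck_on_is_partial k U f i p :
  Ck_on k.+1 U f -> U p -> is_derive p (basis_vec R i) f (partial i f p).
Proof. by case=> _ /(_ i)[df _] Up; exact: DeriveDef (df _ Up) _. Qed.

Lemma Ck_on_partial k U f i : Ck_on k.+1 U f -> Ck_on k U (partial i f).
Proof. by case=> _ /(_ i)[]. Qed.

Lemma is_derive_partial i f p d :
  is_derive p (basis_vec R i) f d -> partial i f p = d.
Proof. by move=> df; exact: derive_val. Qed.

Lemma partial_open_eq U f g i p : open U -> U p ->
  (forall q, U q -> f q = g q) -> partial i f p = partial i g p.
Proof.
move=> oU Up fg; apply: near_eq_derive.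
by near=> q; apply: fg; near: q; exact: open_nbhs_nbhs.
Unshelve. all: by end_near. Qed.

(** On an open set, equality on [U] is equality near each of its points, so it passes to the partial
    derivatives and the induction goes through. *)
Lemma Ck_on_eq k U f g : open U -> (forall q, U q -> f q = g q) ->
  Ck_on k U f -> Ck_on k U g.
Proof.
move=> oU; elim: k f g => [|k IH] f g fg [cf df].
  by split=> // p Up; exact: continuous_open_eq oU Up fg (cf _ Up).
split=> [p Up|i]; first by exact: continuous_open_eq oU Up fg (cf _ Up).
have [dfi Cf] := df i; split=> [p Up|].
  have : is_derive p (basis_vec R i) f (partial i f p).
    by apply: DeriveDef => //; exact: dfi.
  by move=> /(is_derive_open_eq oU Up fg) [].
by apply: IH Cf => q Uq; exact: partial_open_eq oU Uq fg.
Qed.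

(** The induction step for all later regularity proofs: the partials may be given by explicit
    formulas valid on [U] alone. *)
Lemma Ck_onS k U f (g : 'I_n -> 'rV[R]_n -> R) : open U ->
  (forall p, U p -> {for p, continuous f}) ->
  (forall i p, U p -> is_derive p (basis_vec R i) f (g i p)) ->
  (forall i, Ck_on k U (g i)) -> Ck_on k.+1 U f.
Proof.
move=> oU cf df Cg; split=> // i; split=> [p Up|].
  by have [] := df i p Up.
by apply: Ck_on_eq (Cg i) => // p Up; exact/esym/is_derive_partial/df.
Qed.

Lemma Ck_onW k U f : Ck_on k.+1 U f -> Ck_on k U f.
Proof.
elim: k f => [|k IH] f [cf df]; split=> // i; have [dfi Cf] := df i.
by split=> //; exact: IH.
Qed.

Lemma Ck_on_cst k U (c : R) : open U -> Ck_on k U (fun=> c).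
Proof.
move=> oU; elim: k c => [|k IH] c.
  by split=> // p _; exact: cst_continuous.
by apply: (Ck_onS (g := fun _ _ => 0)) => // p _; exact: cst_continuous.
Qed.

Lemma Ck_on_coord k U (i : 'I_n) : open U -> Ck_on k U (fun p => p 0 i).
Proof.
move=> oU; case: k => [|k]; first by split=> // p _; exact: coord_continuous.
apply: (Ck_onS (g := fun j _ => (basis_vec R j) 0 i)) => //.
- by move=> p _; exact: coord_continuous.
- move=> j p _.
  have : is_derive (p 0 i) ((basis_vec R j) 0 i) (@idfun R) ((basis_vec R j) 0 i).
    exact: is_derive_id.
  by apply: is_derive_along => t /=; rewrite !mxE.
- by move=> j; exact: Ck_on_cst.
Qed.

Lemma Ck_onD k U f g : open U -> Ck_on k U f -> Ck_on k U g ->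
  Ck_on k U (fun p => f p + g p).
Proof.
move=> oU; elim: k f g => [|k IH] f g Cf Cg.
  split=> // p Up.
  by apply: continuousD; [exact: Ck_on_continuous Cf Up|exact: Ck_on_continuous Cg Up].
apply: (Ck_onS (g := fun i p => partial i f p + partial i g p)) => //.
- move=> p Up.
  by apply: continuousD; [exact: Ck_on_continuous Cf Up|exact: Ck_on_continuous Cg Up].
- by move=> i p Up; apply: (@is_deriveD _ _ _ f g);
    [exact: (Ck_on_is_partial i Cf Up)|exact: (Ck_on_is_partial i Cg Up)].
- by move=> i; apply: IH; exact: Ck_on_partial.
Qed.

Lemma is_partialM i f g p df dg :
  is_derive p (basis_vec R i) f df -> is_derive p (basis_vec R i) g dg ->
  is_derive p (basis_vec R i) (fun q => f q * g q) (f p * dg + g p * df).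
Proof. by move=> df' dg'; exact: (@is_deriveM _ _ f g). Qed.

Lemma Ck_onM k U f g : open U -> Ck_on k U f -> Ck_on k U g ->
  Ck_on k U (fun p => f p * g p).
Proof.
move=> oU; elim: k f g => [|k IH] f g Cf Cg.
  split=> // p Up.
  by apply: continuousM; [exact: Ck_on_continuous Cf Up|exact: Ck_on_continuous Cg Up].
apply: (Ck_onS (g := fun i p => f p * partial i g p + g p * partial i f p)) => //.
- move=> p Up.
  by apply: continuousM; [exact: Ck_on_continuous Cf Up|exact: Ck_on_continuous Cg Up].
- by move=> i p Up; apply: is_partialM;
    [exact: (Ck_on_is_partial i Cf Up)|exact: (Ck_on_is_partial i Cg Up)].
(* Each product-rule term pairs a partial with an undifferentiated factor, which [Ck_onW] lowers to
   order [k]. *)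
- by move=> i; apply: Ck_onD => //; apply: IH; (exact: Ck_onW || exact: Ck_on_partial).
Qed.

End Ck.

(** * Real powers of [y] on the half-plane *)

Section HalfPlane.
Context {R : realType}.
Implicit Types (q : 'rV[R]_2) (f : 'rV[R]_2 -> R).

Lemma open_half_plane : open (@half_plane R).
Proof.
have -> : @half_plane R = (fun q => q 0 1) @^-1` [set y | 0 < y] by [].
by apply: open_comp => [q _|]; [exact: coord_continuous|exact: open_gt].
Qed.

Lemma powR_pred (y a : R) : 0 < y -> y `^ (a - 1) = y `^ a / y.
Proof.
by move=> y0; rewrite powRD ?powR_inv1 ?ltW// (gt_eqF y0) implybT.
Qed.

Lemma point2E (x y : R) : point2 x y = x *: basis_vec R 0 + y *: basis_vec R 1.
Proof.
apply/rowP => i; rewrite !mxE /=.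
by case: i => [[|[|//]] Hi]; rewrite /= ?mulr1 ?mulr0 ?addr0 ?add0r.
Qed.

Lemma is_partial_powR0 q (a : R) :
  is_derive q (basis_vec R 0) (fun q => q 0 1 `^ a) 0.
Proof.
have : is_derive (q 0 1) (0 : R) (@cst R R (q 0 1 `^ a)) 0 by exact: is_derive_cst.
by apply: is_derive_along => t; rewrite /= !mxE/= mulr0 add0r.
Qed.

Lemma is_partial_powR1 q (a : R) : half_plane q ->
  is_derive q (basis_vec R 1) (fun q => q 0 1 `^ a) (a * q 0 1 `^ (a - 1)).
Proof.
move=> q0; have := is_derive1_powR a q0.
by apply: is_derive_along => t; rewrite !mxE.
Qed.

Lemma Ck_on_powR k (a : R) :
  Ck_on k (@half_plane R) (fun q => q 0 1 `^ a).
Proof.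
have oU := open_half_plane.
have ca b q : half_plane q -> {for q, continuous (fun q => q 0 1 `^ b)}.
  move=> q0; apply: (@continuous_comp _ _ _ (fun q => q 0 1) (@powR R ^~ b)).
    exact: coord_continuous.
  apply: differentiable_continuous; apply/derivable1_diffP.
  by have [] := is_derive1_powR b q0.
(* The exponent is generalised because each differentiation lowers it by one. *)
elim: k a => [|k IH] a; first by split=> // q q0; exact: ca.
apply: (Ck_onS (g := fun i q => if i == 0 then 0 else a * q 0 1 `^ (a - 1))) => //.
- by move=> q q0; exact: ca.
- move=> i q q0.
  case: (eqVneq i 0) => [->|i0]; first exact: is_partial_powR0.
  have -> : i = 1 by case: i i0 => [[|[|//]] Hi] // _; exact/val_inj.
  exact: is_partial_powR1.
- move=> i; case: (i == 0); first exact: Ck_on_cst.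
  by apply: Ck_onM => //; exact: Ck_on_cst.
Qed.

End HalfPlane.

(** * Cylindrical coordinates and the Laplacian of axially symmetric functions *)

Section Cylindrical.
Context {R : realType}.
Implicit Types (p : 'rV[R]_3) (f : 'rV[R]_2 -> R).

Definition radius p : R := Num.sqrt (p 0 1 ^+ 2 + p 0 2 ^+ 2).

Definition cylindrical p : 'rV[R]_2 := point2 (p 0 0) (radius p).

Lemma cylindrical1 p : cylindrical p 0 1 = radius p.
Proof. by rewrite mxE. Qed.

(** A sum of two squares vanishes only if both terms do. Positivity exhibits the complement of the
    axis as an open preimage and makes the square root differentiable there. *)
Lemma off_axisE p : (~` @x1_axis R) p <-> 0 < p 0 1 ^+ 2 + p 0 2 ^+ 2.
Proof.
rewrite lt_def paddr_eq0 ?sqr_ge0// addr_ge0 ?sqr_ge0// andbT !sqrf_eq0.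
rewrite /x1_axis /=; split.
  by move=> np; apply/negP => /andP[/eqP a /eqP b]; exact: np.
by move=> /negP np [a b]; apply: np; rewrite a b eqxx.
Qed.

Lemma radius_gt0 p : (~` @x1_axis R) p -> 0 < radius p.
Proof. by move=> /off_axisE; rewrite -sqrtr_gt0. Qed.

Lemma half_plane_cylindrical p :
  (~` @x1_axis R) p -> half_plane (cylindrical p).
Proof. by move=> /radius_gt0; rewrite /half_plane /= cylindrical1. Qed.

Lemma sqr_radius p : radius p ^+ 2 = p 0 1 ^+ 2 + p 0 2 ^+ 2.
Proof. by rewrite sqr_sqrtr// addr_ge0// sqr_ge0. Qed.

Lemma cylindrical_surj (q : 'rV[R]_2) : half_plane q ->
  exists2 p, (~` @x1_axis R) p & cylindrical p = q.
Proof.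
(* The lift is [(x, y, 0)], whose radius [sqrt (y^2)] is [y] because [y > 0]. *)
move=> q0; exists (\row_i (if i == 0 then q 0 0 else if i == 1 then q 0 1 else 0)).
  by apply/off_axisE; rewrite !mxE /= expr0n/= addr0 exprn_gt0.
apply/rowP => i; rewrite !mxE /radius /= !mxE /= expr0n/= addr0 sqrtr_sqr gtr0_norm//.
by case: i => [[|[|//]] Hi]; congr (q _ _); exact/val_inj.
Qed.

Lemma continuous_sqr_radius :
  continuous (fun p => p 0 1 ^+ 2 + p 0 2 ^+ 2).
Proof.
move=> p.
have c (i : 'I_3) : {for p, continuous (fun p => p 0 i ^+ 2)}.
  by apply: (@continuous_comp _ _ _ (fun p => p 0 i) (fun x => x ^+ 2));
    [exact: coord_continuous|exact: exprn_continuous].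
exact: (continuousD (c 1) (c 2)).
Qed.

Lemma open_off_axis : open (~` @x1_axis R).
Proof.
have -> : ~` @x1_axis R =
    (fun p => p 0 1 ^+ 2 + p 0 2 ^+ 2) @^-1` [set y | 0 < y].
  by apply/seteqP; split=> p /off_axisE.
by apply: open_comp => [p _|]; [exact: continuous_sqr_radius|exact: open_gt].
Qed.

Lemma continuous_cylindrical : continuous cylindrical.
Proof.
(* Expanding in the standard basis reduces continuity to that of two scalar coefficients. *)
have -> : cylindrical =
  (fun p => p 0 0 *: basis_vec R 0 + radius p *: basis_vec R 1).
  by apply/funext => p; exact: point2E.
move=> p.
have c0 : {for p, continuous (fun p => p 0 0 *: basis_vec R (0 : 'I_2))}.
  by apply: continuousZr_tmp; exact: coord_continuous.
have c1 : {for p, continuous (fun p => radius p *: basis_vec R (1 : 'I_2))}.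
  apply: continuousZr_tmp; apply: (@continuous_comp _ _ _ _ (@Num.sqrt R)).
    exact: continuous_sqr_radius.
  exact: sqrt_continuous.
exact: (continuousD c0 c1).
Qed.

(** Moving along the axis keeps the radius fixed, so the image is a straight line in direction
    [x]. *)
Lemma is_partial_cylindrical0 f p (d : R) :
  is_derive (cylindrical p) (basis_vec R 0) f d ->
  is_derive p (basis_vec R 0) (f \o cylindrical) d.
Proof.
apply: is_derive_along => t /=; congr f; rewrite /cylindrical /radius !point2E !mxE /=.
by rewrite mulr0 mulr1 !add0r scalerDl addrA.
Qed.

Lemma is_partial_coord (i j : 'I_3) p :
  is_derive p (basis_vec R j) (fun p => p 0 i) (i == j)%:R.
Proof.
have : is_derive (p 0 i) ((i == j)%:R : R) (@idfun R) (i == j)%:R.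
  exact: is_derive_id.
by apply: is_derive_along => t /=; rewrite !mxE.
Qed.

Lemma is_partial_radius (i : 'I_3) p : i != 0 -> (~` @x1_axis R) p ->
  is_derive p (basis_vec R i) radius (p 0 i / radius p).
Proof.
move=> i0 Up.
have ds := is_derive1_sqrt ((off_axisE p).1 Up).
have dsq (j : 'I_3) := is_partialM (is_partial_coord j i p) (is_partial_coord j i p).
have dg : is_derive p (basis_vec R i) (fun p => p 0 1 ^+ 2 + p 0 2 ^+ 2) (2 * p 0 i).
  (* The Kronecker deltas select the one square that varies; [2 * p 0 i] then meets the factor
     [(2 * r)^-1] from the square root. *)
  have -> : 2 * p 0 i = (p 0 1 * (1 == i)%:R + p 0 1 * (1 == i)%:R) +
                        (p 0 2 * (2 == i)%:R + p 0 2 * (2 == i)%:R).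
    case: i i0 {dsq} => [[|[|[|//]]] Hi] // _; rewrite /= ?mulr0 ?mulr1 ?addr0 ?add0r.
      by rewrite mulr_natl mulr2n; congr (p _ _ + p _ _); exact/val_inj.
    by rewrite mulr_natl mulr2n; congr (p _ _ + p _ _); exact/val_inj.
  exact: (@is_deriveD _ _ _ _ _ _ _ _ _ (dsq 1) (dsq 2)).
have := @is_derive_comp _ _ _ (fun p => p 0 1 ^+ 2 + p 0 2 ^+ 2) _ _ _ _ ds dg.
by rewrite -/(radius p) invfM mulrACA mulVf ?pnatr_eq0// mul1r mulrC.
Qed.

(** Here [x] stays fixed and only the radius varies, though not linearly: the chain rule is applied
    to [s |-> f (x, s)] after [radius]. *)
Lemma is_partial_cylindrical1 f (i : 'I_3) p (d : R) :
  i != 0 -> (~` @x1_axis R) p ->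
  is_derive (cylindrical p) (basis_vec R 1) f d ->
  is_derive p (basis_vec R i) (f \o cylindrical) (d * (p 0 i / radius p)).
Proof.
move=> i0 Up df.
have dF : is_derive (radius p) 1 (fun s => f (point2 (p 0 0) s)) d.
  apply: is_derive_along df => t; congr f.
  by rewrite -[t *: (1 : R)]/(t * 1) mulr1 /cylindrical !point2E scalerDl addrCA.
have := is_derive_comp dF (is_partial_radius i0 Up).
apply: is_derive_along => t /=; congr (f (point2 _ _)).
by rewrite !mxE eq_sym (negbTE i0) mulr0 add0r.
Qed.

(* [f_y / y], with [y^-1] written as a real power so that [Ck_on_powR] applies. *)
Definition radial_slope f : 'rV[R]_2 -> R :=
  fun q => partial 1 f q * q 0 1 `^ (-1).

Lemma Ck_on_radial_slope k f :
  Ck_on k.+1 (@half_plane R) f -> Ck_on k (@half_plane R) (radial_slope f).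
Proof.
move=> Cf; have oH := @open_half_plane R.
by apply: Ck_onM => //; [exact: Ck_on_partial|exact: Ck_on_powR].
Qed.

(** The chain-rule term [f_y * (p_i / r)] is regrouped as [(f_y / r) * p_i], so that its first
    factor is again a half-plane function composed with [cylindrical]. *)
Definition cylindrical_partial (i : 'I_3) f p : R :=
  if i == 0 then partial 0 f (cylindrical p)
  else radial_slope f (cylindrical p) * p 0 i.

Lemma cylindrical_partial_neq0 f (i : 'I_3) p :
  i != 0 -> (~` @x1_axis R) p ->
  cylindrical_partial i f p = partial 1 f (cylindrical p) / radius p * p 0 i.
Proof.
move=> i0 Up; rewrite /cylindrical_partial (negbTE i0) /radial_slope.
by rewrite cylindrical1 powR_inv1// ltW// radius_gt0.
Qed.

Lemma is_partial_cylindrical k f (i : 'I_3) p :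
  Ck_on k.+1 (@half_plane R) f -> (~` @x1_axis R) p ->
  is_derive p (basis_vec R i) (f \o cylindrical) (cylindrical_partial i f p).
Proof.
move=> Cf Up; have Hp := half_plane_cylindrical Up.
case: (eqVneq i 0) => [->|i0].
  exact: is_partial_cylindrical0 (Ck_on_is_partial 0 Cf Hp).
have := is_partial_cylindrical1 i0 Up (Ck_on_is_partial 1 Cf Hp).
by rewrite cylindrical_partial_neq0// -mulrA (mulrC (p 0 i)).
Qed.

(** The induction closes since the partials are compositions of the same kind, up to a coordinate
    factor, with [partial 0 f] or [radial_slope f] of one order less. *)
Lemma Ck_on_cylindrical k f :
  Ck_on k (@half_plane R) f -> Ck_on k (~` @x1_axis R) (f \o cylindrical).
Proof.
have oU := open_off_axis; have oH := @open_half_plane R.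
have cc g j p : Ck_on j (@half_plane R) g -> (~` @x1_axis R) p ->
    {for p, continuous (g \o cylindrical)}.
  move=> Cg Up; apply: continuous_comp; first exact: continuous_cylindrical.
  exact: Ck_on_continuous Cg (half_plane_cylindrical Up).
elim: k f => [|k IH] f Cf; first by split=> // p; exact: cc Cf.
apply: (Ck_onS (g := fun i => cylindrical_partial i f)) => //.
- by move=> p; exact: cc Cf.
- by move=> i p; exact: is_partial_cylindrical Cf.
- move=> i; rewrite /cylindrical_partial; case: (i == 0).
    by apply: IH; exact: Ck_on_partial.
  apply: Ck_onM => //; last exact: Ck_on_coord.
  by apply: IH; exact: Ck_on_radial_slope.
Qed.

(** The last two terms, [f_yy + f_y / y], are the radial part of the Laplacian in the plane of the
    last two coordinates. *)
Definition axial_laplacian f : 'rV[R]_2 -> R :=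
  fun q => partial 0 (partial 0 f) q + partial 1 (partial 1 f) q
           + partial 1 f q / q 0 1.

Lemma partial_radial_slope f q :
  Ck_on 2 (@half_plane R) f -> half_plane q ->
  partial 1 (radial_slope f) q =
  (partial 1 (partial 1 f) q - partial 1 f q / q 0 1) / q 0 1.
Proof.
move=> Cf q0.
have := is_partialM (Ck_on_is_partial 1 (Ck_on_partial 1 Cf) q0)
                    (is_partial_powR1 (-1) q0).
move/is_derive_partial => ->; rewrite powR_pred// powR_inv1 ?ltW//.
by rewrite mulN1r mulrN mulrBl addrC mulrC mulrA.
Qed.

Lemma laplacian3E (g : 'rV[R]_3 -> R) p :
  laplacian g p = partial 0 (partial 0 g) p
    + (partial 1 (partial 1 g) p + partial 2 (partial 2 g) p).
Proof.
(* The summand is made opaque, so that only the ordinals produced by [big_ord_recl] remain to be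
   matched. *)
rewrite /laplacian; set F := BIG_F.
rewrite -/(F 0) -/(F 1) -/(F 2); move: F => F.
by rewrite !big_ord_recl big_ord0 addr0; congr (F _ + (F _ + F _)); exact/val_inj.
Qed.

(** With [G = f_y / y], each direction [i != 0] contributes [G + (G_y / r) * p_i^2]. Since the two
    squares add up to [r^2], the sum is [2 G + r G_y = f_yy + f_y / r]. *)
Lemma laplacian_cylindrical f p :
  Ck_on 2 (@half_plane R) f -> (~` @x1_axis R) p ->
  laplacian (f \o cylindrical) p = axial_laplacian f (cylindrical p).
Proof.
move=> Cf Up; have Hp := half_plane_cylindrical Up.
have CG := Ck_on_radial_slope Cf.
have slopeE : radial_slope f (cylindrical p) =
    partial 1 f (cylindrical p) / radius p.
  by rewrite /radial_slope cylindrical1 powR_inv1// ltW// radius_gt0.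
have dslopeE := partial_radial_slope Cf Hp; rewrite cylindrical1 in dslopeE.
(* The outer derivative sees the inner one only near [p], where the explicit formula holds. *)
have partialE (i : 'I_3) : partial i (partial i (f \o cylindrical)) p =
    partial i (cylindrical_partial i f) p.
  apply: (partial_open_eq i open_off_axis Up) => q Uq.
  exact: is_derive_partial (is_partial_cylindrical i Cf Uq).
have partial2E (i : 'I_3) : i != 0 -> partial i (partial i (f \o cylindrical)) p =
    partial 1 f (cylindrical p) / radius p
    + (partial 1 (partial 1 f) (cylindrical p)
       - partial 1 f (cylindrical p) / radius p) / radius p / radius p
      * p 0 i ^+ 2.
  move=> i0; rewrite partialE.
  rewrite /cylindrical_partial (negbTE i0).
  have := is_partialM (is_partial_cylindrical i CG Up) (is_partial_coord i i p).
  move/is_derive_partial => ->.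
  rewrite cylindrical_partial_neq0// eqxx mulr1 /= slopeE dslopeE; congr (_ + _).
  by rewrite mulrC expr2 [in RHS]mulrA.
have partial0E : partial 0 (partial 0 (f \o cylindrical)) p =
    partial 0 (partial 0 f) (cylindrical p).
  rewrite partialE; apply: is_derive_partial.
  exact: (is_partial_cylindrical 0 (Ck_on_partial 0 Cf) Up).
apply: etrans (laplacian3E _ _) _.
apply: etrans (congr2 +%R partial0E
  (congr2 +%R (partial2E 1 isT) (partial2E 2 isT))) _.
rewrite /axial_laplacian cylindrical1.
have r0 := radius_gt0 Up; have rE := sqr_radius p.
(* Eliminating one square leaves a rational identity with [r != 0], in which the other square
   cancels. *)
have -> : p 0 2 ^+ 2 = radius p ^+ 2 - p 0 1 ^+ 2 by rewrite rE addrC addKr.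
move: (radius p) (partial 0 _ _) (partial 1 (partial 1 f) _) (partial 1 f _) r0.
move=> r hxx hyy hy r0 {slopeE dslopeE partialE partial2E partial0E rE}.
by field; exact: lt0r_neq0.
Qed.

End Cylindrical.

(** * Multiplication by [y^(1/2)] and the equivalence *)

(** Let [s = y^(1/2)]. Then [2 f_y s' = s f_y / y] is exactly the first-order term, and
    [y^2 f s'' = - f s / 4] cancels the term with coefficient [1/4]. *)
Lemma laplace_beltrami_mul_sqrt {R : realType} (f : 'rV[R]_2 -> R) q :
  Ck_on 2 (@half_plane R) f -> half_plane q ->
  laplace_beltrami (fun q => f q * q 0 1 `^ 2^-1) q
    + 4^-1 * (f q * q 0 1 `^ 2^-1) =
  q 0 1 ^+ 2 * q 0 1 `^ 2^-1 * axial_laplacian f q.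
Proof.
move=> Cf q0.
have E0 : partial 0 (partial 0 (fun q => f q * q 0 1 `^ 2^-1)) q =
    partial 0 (partial 0 f) q * q 0 1 `^ 2^-1.
  rewrite (partial_open_eq (g := fun q => partial 0 f q * q 0 1 `^ 2^-1) 0
    open_half_plane q0).
    have := is_partialM (Ck_on_is_partial 0 (Ck_on_partial 0 Cf) q0)
                        (is_partial_powR0 q 2^-1).
    by move/is_derive_partial => ->; rewrite mulr0 add0r mulrC.
  move=> p p0; have := is_partialM (Ck_on_is_partial 0 Cf p0)
                        (is_partial_powR0 p 2^-1).
  by move/is_derive_partial => ->; rewrite mulr0 add0r mulrC.
have E1 : partial 1 (partial 1 (fun q => f q * q 0 1 `^ 2^-1)) q =
    partial 1 (partial 1 f) q * q 0 1 `^ 2^-1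
    + partial 1 f q * q 0 1 `^ (2^-1 - 1)
    + f q * (2^-1 * ((2^-1 - 1) * q 0 1 `^ (2^-1 - 1 - 1))).
  rewrite (partial_open_eq (g := fun q => f q * (2^-1 * q 0 1 `^ (2^-1 - 1))
     + q 0 1 `^ 2^-1 * partial 1 f q) 1 open_half_plane q0); last first.
    move=> p p0; have := is_partialM (Ck_on_is_partial 1 Cf p0)
                          (is_partial_powR1 2^-1 p0).
    by move/is_derive_partial.
  have dc : is_derive q (basis_vec R 1) (fun _ => 2^-1 : R) 0 by exact: is_derive_cst.
  have d1 := is_partialM (Ck_on_is_partial 1 Cf q0)
               (is_partialM dc (is_partial_powR1 (2^-1 - 1) q0)).
  have d2 := is_partialM (is_partial_powR1 2^-1 q0)
               (Ck_on_is_partial 1 (Ck_on_partial 1 Cf) q0).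
  have := @is_deriveD _ _ _ _ _ _ _ _ _ d1 d2.
  move/is_derive_partial => -> {dc d1 d2 E0}.
  move: (partial 1 (partial 1 f) q) (partial 1 f q) (f q) => hyy hy h.
  (* The three powers act as independent unknowns here; the two halves of the mixed term add up to
     [hy * y1]. *)
  move: (_ `^ 2^-1) (_ `^ (2^-1 - 1)) (_ `^ (2^-1 - 1 - 1)) => y0 y1 y2.
  by field.
(* Now the lowered powers become [s / y] and [s / y / y], leaving a rational identity in [y] and
   [s]. *)
rewrite /laplace_beltrami E0 E1 !powR_pred// /axial_laplacian {E0 E1}.
move: (partial 0 (partial 0 f) q) (partial 1 (partial 1 f) q) (partial 1 f q) (f q).
move=> hxx hyy hy h; have := lt0r_neq0 q0.
move: (q 0 1) (q 0 1 `^ 2^-1) => y s y0.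
by field.
Qed.

Theorem mainTheorem5 (R : realType) (h : 'rV[R]_2 -> R) (u : 'rV[R]_3 -> R)
  (hC2 : Ck_on 2 (@half_plane R) h)
  (hu : forall p : 'rV[R]_3, (~` @x1_axis R) p ->
    u p = h (point2 (p 0 0) (Num.sqrt (p 0 1 ^+ 2 + p 0 2 ^+ 2)))) :
  harmonic_on (~` @x1_axis R) u <->
  helmholtz_solution (4^-1) (fun q : 'rV[R]_2 => h q * (q 0 1 `^ (2^-1))).
Proof.
have oU := @open_off_axis R; have oH := @open_half_plane R.
have huE p : (~` @x1_axis R) p -> (h \o cylindrical) p = u p.
  by move=> Up; rewrite hu.
have Cu : Ck_on 2 (~` @x1_axis R) u.
  exact: Ck_on_eq oU huE (Ck_on_cylindrical hC2).
(* The equality of [u] and [h \o cylindrical] is given off the axis, so openness is invoked once for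
   each of the two derivatives. *)
have lapE p : (~` @x1_axis R) p -> laplacian u p = axial_laplacian h (cylindrical p).
  move=> Up; apply: etrans (laplacian_cylindrical hC2 Up).
  apply: eq_bigr => i _; apply/esym/(partial_open_eq i oU Up) => q Uq.
  exact: partial_open_eq oU Uq huE.
(* Both regularity clauses come from [hC2]; what passes from one side to the other is the
   equation. *)
split=> [[_ lap0]|[_ sol0]].
- split=> [|q q0]; first exact: (Ck_onM oH hC2 (Ck_on_powR 2 2^-1)).
  have [p Up pq] := cylindrical_surj q0.
  apply: etrans (laplace_beltrami_mul_sqrt hC2 q0) _.
  by rewrite -pq -(lapE _ Up) (lap0 _ Up) mulr0.
- split=> [|p Up]; first exact: Cu.
  have Hp := half_plane_cylindrical Up.
  have := etrans (esym (laplace_beltrami_mul_sqrt hC2 Hp)) (sol0 _ Hp).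
  have w0 : 0 < cylindrical p 0 1 ^+ 2 * cylindrical p 0 1 `^ 2^-1.
    by rewrite mulr_gt0 ?exprn_gt0 ?powR_gt0.
  by rewrite (lapE _ Up) => /eqP; rewrite mulf_eq0 (gt_eqF w0) => /eqP.
Qed.
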